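(* Let $k_0>0$ and assume that $\det(P_{\theta,\Xi}(k_0^2))\neq 0$. Then the data $\{G_{\theta,\Xi}(k_0^2,x,y)\}_{x,y\in P,\,x\neq y}$ uniquely determine $\Xi=\{\xi_1,\dots,\xi_n\}\subset\mathbb{R}^3_-$ and the self-adjoint $n\times n$ matrix $\theta$ in $\mathbb{C}^n$.
   Context: Notation: $\mathbb{R}^3_-=\{x=(x_1,x_2,x_3)\in\mathbb{R}^3: x_3<0\}$ and $P=\{x\in\mathbb{R}^3: x_3=0\}$ (the plane $P$ is not to be confused with the matrices $P_{\theta,\Xi}(z)$). Let $n\in\mathbb{N}$, let $\Xi=\{\xi_1,\dots,\xi_n\}\subset\mathbb{R}^3_-$ consist of pairwise distinct points, and let $\theta$ be a self-adjoint $n\times n$ matrix in $\mathbb{C}^n$ such that none of the numbers $((1/2)+m)\pi$, $m\in\mathbb{Z}$, belongs to the spectrum of $\theta$. The matrix $\theta$ enters below through the self-adjoint matrix $\tan(\theta/2)$. For $z\in\mathbb{C}\setminus\mathbb{R}$ let $z^{1/2}$ be the square root with $\mathrm{Im}(z^{1/2})>0$; for $z=k_0^2$ take $(k_0^2)^{1/2}=k_0$ (boundary value from the upper half-plane). Put $$G_0(z,x)=\frac{\exp(i z^{1/2}|x|)}{4\pi|x|},\quad x\in\mathbb{R}^3\setminus\{0\},$$ and $\mathrm{Re}(G_0(i,x))=[G_0(i,x)+G_0(-i,x)]/2$. The $n\times n$ matrix $P_{\theta,\Xi}(z)$ is given through its inverse by $$\bigl(P_{\theta,\Xi}(z)^{-1}\bigr)_{j,j'}=\begin{cases}-(4\pi)^{-1}i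 z^{1/2}-(4\pi)^{-1}2^{-1/2}+(\tan(\theta/2))_{j,j}, & j=j',\\[1mm] -G_0(z,\xi_j-\xi_{j'})+\mathrm{Re}(G_0(i,\xi_j-\xi_{j'}))+(\tan(\theta/2))_{j,j'}, & j\neq j'.\end{cases}$$ The operator $-\Delta_{\theta,\Xi}$ is the self-adjoint extension in $L^2(\mathbb{R}^3)$ of the closure of $-\Delta|_{C_0^\infty(\mathbb{R}^3\setminus\Xi)}$ whose resolvent, for $z\in\mathbb{C}\setminus\mathbb{R}$, is $$(-\Delta_{\theta,\Xi}-z)^{-1}=(-\Delta-z)^{-1}+\sum_{j,j'=1}^n P_{\theta,\Xi}(z)_{j,j'}\,(G_0(\overline z,\cdot-\xi_{j'}),\cdot)\,G_0(z,\cdot-\xi_j),$$ where $-\Delta$ has domain $H^{2,2}(\mathbb{R}^3)$ and the inner product is linear in the second argument. Its Green's function $G_{\theta,\Xi}(z,x,y)=(-\Delta_{\theta,\Xi}-z)^{-1}(x,y)$ is $$G_{\theta,\Xi}(z,x,y)=G_0(z,x-y)+\sum_{j,j'=1}^n P_{\theta,\Xi}(z)_{j,j'}\,G_0(z,x-\xi_j)\,G_0(z,y-\xi_{j'}),$$ for $\det(P_{\theta,\Xi}(z))\neq0$, $x,y\in\mathbb{R}^3\setminus\Xi$, $x\neq y$; at $z=k_0^2$ it is given by the same formula with $(k_0^2)^{1/2}=k_0$.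
   Formalization: θ=0 and θ=2πI give the same data, so θ is not determined; proved instead: Ξ and tan(θ/2) are determined up to relabelling, and θ itself if both spectra lie in a common [a,a+2π). Also assumed: no (1/2+m)π is in the spectrum of θ/2, so that tan(θ/2) exists. *)

(* Defs.v *)
From HB Require Import structures.
From mathcomp Require Import all_boot all_order all_algebra.
From mathcomp Require Import spectral sesquilinear.
From mathcomp Require Import complex.
From mathcomp Require Import all_classical all_reals all_analysis.
Set Implicit Arguments.
Unset Strict Implicit.
Unset Printing Implicit Defensive.

Import Order.TTheory GRing.Theory Num.Theory.
Local Open Scope ring_scope.
Local Open Scope complex_scope.

Section PointInteractions.
Variable R : realType.

(* The library norm of a row vector is the sup norm. *)
Definition enorm (x : 'rV[R]_3) : R := Num.sqrt (\sum_(i < 3) x 0 i ^+ 2).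

Definition lower_half_space (x : 'rV[R]_3) : Prop := x 0 ord_max < 0.

Definition on_plane (x : 'rV[R]_3) : Prop := x 0 ord_max = 0.

Definition expC (z : R[i]) : R[i] :=
  (expR (complex.Re z))%:C * (cos (complex.Im z) +i* sin (complex.Im z)).

(* [sqrtC] is the square root with nonnegative imaginary part and, on
   nonnegative reals, the nonnegative root: this is the branch with
   Im (z^(1/2)) > 0 off the real axis and (k0^2)^(1/2) = k0 for k0 > 0. *)
Definition G0 (z : R[i]) (x : 'rV[R]_3) : R[i] :=
  expC ('i * sqrtC z * (enorm x)%:C) / (4 * pi * enorm x)%:C.

Definition ReG0i (x : 'rV[R]_3) : R[i] := (G0 'i x + G0 (- 'i) x) / 2.

(* Functional calculus f(A) of a self-adjoint matrix A, through its unitary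
   diagonalization A = S^-1 D S with D real. *)
Definition hermfun n (f : R -> R) (A : 'M[R[i]]_n) : 'M[R[i]]_n :=
  invmx (spectralmx A)
    *m diag_mx (map_mx (fun l : R[i] => (f (complex.Re l))%:C) (spectral_diag A))
    *m spectralmx A.

Definition tan_half n (theta : 'M[R[i]]_n) : 'M[R[i]]_n :=
  hermfun (fun t => tan (t / 2)) theta.

Definition Pinv n (theta : 'M[R[i]]_n) (xi : 'I_n -> 'rV[R]_3) (z : R[i]) :
    'M[R[i]]_n :=
  \matrix_(j, j')
    if j == j' then
      - (4 * pi)^-1%:C * 'i * sqrtC z - ((4 * pi)^-1 * (Num.sqrt 2)^-1)%:C
      + tan_half theta j j
    else
      - G0 z (xi j - xi j') + ReG0i (xi j - xi j') + tan_half theta j j'.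

(* [invmx] leaves a singular matrix unchanged, so \det (Pmx theta xi z) != 0
   says exactly that [Pinv theta xi z] is invertible with inverse [Pmx]. *)
Definition Pmx n (theta : 'M[R[i]]_n) (xi : 'I_n -> 'rV[R]_3) (z : R[i]) :
    'M[R[i]]_n :=
  invmx (Pinv theta xi z).

Definition Green n (theta : 'M[R[i]]_n) (xi : 'I_n -> 'rV[R]_3) (z : R[i])
    (x y : 'rV[R]_3) : R[i] :=
  G0 z (x - y)
  + \sum_(j < n) \sum_(j' < n)
      Pmx theta xi z j j' * G0 z (x - xi j) * G0 z (y - xi j').

Definition avoids_odd_half_pi n (A : 'M[R[i]]_n) : Prop :=
  forall m : int, ~~ eigenvalue A ((2^-1 + m%:~R) * pi)%:C.

(* The condition on theta / 2 is what makes tan (theta / 2) exist (in the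
   library tan is a total function); it does not follow from the one on
   theta. *)
Definition admissible n (theta : 'M[R[i]]_n) (xi : 'I_n -> 'rV[R]_3) : Prop :=
  [/\ injective xi,
      forall j, lower_half_space (xi j),
      theta \is hermsymmx,
      avoids_odd_half_pi theta
    & avoids_odd_half_pi (2^-1 *: theta)].

(* A window of length 2 pi on which t |-> tan (t / 2) is injective. *)
Definition spectrum_in_window n (a : R) (A : 'M[R[i]]_n) : Prop :=
  forall t : R, eigenvalue A t%:C -> a <= t < a + 2 * pi.

End PointInteractions.

(* Main.v *)
Require Import Defs.
From mathcomp Require Import all_boot all_order all_algebra.
From mathcomp Require Import spectral sesquilinear.
From mathcomp Require Import complex.
From mathcomp Require Import all_classical all_reals all_analysis ring lra zify.

(** On the plane, the difference of the two Green's functions is a bilinear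
combination of the functions [x |-> G0 (x - xi)], [y |-> G0 (y - xi)], with the
entries of the two matrices [Pmx] as coefficients.  Spherical waves emitted from
distinct points of the lower half-space are linearly independent on the plane
([sources_independent]), so the entries attached to each pair of points agree.
As [Pmx] is invertible, no row of it vanishes, hence every source of one
configuration is a source of the other ([matching_source]), and up to this
bijection the matrices [Pmx], then their inverses, then the matrices
[tan (theta / 2)] coincide.  On a window of length [2 * pi] the function
[t |-> tan (t / 2)] is injective, so [theta] is recovered through its spectral
decomposition ([hermfun_intertwine]).

The independence of the waves is the heart of the matter.  Restricted to a line
of the plane, the wave of a source is [exp (i k r) / r], where [r ^+ 2] is a real
quadratic polynomial of the parameter without real root; its complex roots are
branch points of the wave.  In a vanishing combination, choose the source nearest
to the plane and a line through its foot: its branch point [z] is then not a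
branch point of the other waves.  Instead of continuing analytically to [z], one
compares how derivatives behave there.  The derivatives of the other waves have
coefficients regular at [z] in a module of finite rank over polynomials, so that
a combination of finitely many derivatives, with leading coefficient nonzero at
[z], kills all of them at once ([local_dependence]).  The chosen wave would
satisfy the same differential equation, but each derivative is more singular at
[z] than the preceding ones, and so the leading term cannot be compensated
([wave_not_annihilated]). *)

Set Implicit Arguments.
Unset Strict Implicit.
Unset Printing Implicit Defensive.
Import Order.TTheory GRing.Theory Num.Theory.
Import numFieldNormedType.Exports.
Local Open Scope ring_scope.
Local Open Scope complex_scope.

(** * Polynomial relations regular at a point *)

(** Over the discrete valuation ring of fractions without pole at [z], the
submodule generated by a sequence in a free module of finite rank is finitely
generated, so some term [u J] is a combination of the earlier ones; clearing
denominators gives the relation below.  What matters is that the leading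
coefficient [c J] does not vanish at [z]: mere linear dependence over the
fraction field would not give that. *)
Lemma local_dependence (F : fieldType) (z : F) (I : eqType) (r : seq I)
    (u : nat -> I -> {poly F}) :
  exists J (c : nat -> {poly F}), (c J).[z] != 0 /\
    forall i, i \in r -> \sum_(l < J.+1) c l * u l i = 0.
Proof.
elim: r u => [|i r IH] u.
  by exists 0%N, (fun=> 1); split=> //; rewrite hornerC oner_eq0.
have [[l0 ul0]|u0] := pselect (exists l, u l i != 0); last first.
  have [J [c [cJ cr]]] := IH u.
  exists J, c; split=> // j; rewrite inE => /orP[/eqP->|]; last exact: cr.
  apply: big1 => l _; have [->|ul] := eqVneq (u l i) 0; first by rewrite mulr0.
  by case: u0; exists l.
(* The entry [u k i] of least valuation serves as pivot to eliminate the
   coordinate [i] from all later terms. *)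
have exmu : exists m, `[< exists2 l, u l i != 0 & mup z (u l i) = m >].
  by exists (mup z (u l0 i)); apply/asboolP; exists l0.
case: (ex_minnP exmu) => m /asboolP[{ul0 exmu} k uk muk] minm.
have dvd l : ('X - z%:P) ^+ m %| u l i.
  have [->|ul] := eqVneq (u l i) 0; first exact: dvdp0.
  by rewrite -mup_geq //; apply: minm; apply/asboolP; exists l.
have [s sE] : exists s, forall l, u l i = ('X - z%:P) ^+ m * s l.
  exists (fun l => u l i %/ ('X - z%:P) ^+ m) => l.
  by rewrite mulrC divpK.
have skz : (s k).[z] != 0.
  apply/negP => /factor_theorem[p pE].
  have : (m.+1 <= mup z (u k i))%N.
    by rewrite mup_geq // sE pE mulrCA -exprSr dvdp_mull.
  by rewrite muk ltnn.
have [J [c [cJ cr]]] :=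
  IH (fun l j => s k * u (k.+1 + l)%N j - s (k.+1 + l)%N * u k j).
exists (k.+1 + J)%N, (fun l => if (l < k)%N then 0 else
  if l == k then - \sum_(l < J.+1) c l * s (k.+1 + l)%N
  else c (l - k.+1)%N * s k).
have geF l : (k.+1 + l < k)%N = false by lia.
have neF l : (k.+1 + l == k)%N = false by lia.
split=> [|j jr]; first by rewrite geF neF addKn hornerM mulf_neq0.
have -> : (k.+1 + J).+1 = (k.+1 + J.+1)%N by rewrite addnS.
rewrite big_split_ord big_ord_recr /= ltnn eqxx big1 ?add0r => [|l _]; last first.
  by rewrite ltn_ord mul0r.
under [X in _ + X]eq_bigr => l _ do rewrite geF neF addKn.
rewrite mulNr big_distrl /= addrC -sumrB.
move: jr; rewrite inE => /orP[/eqP->|jr].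
  by apply: big1 => l _; rewrite !sE; ring.
by rewrite -[RHS](cr _ jr); apply: eq_bigr => l _; ring.
Qed.

Section PointSources.
Variable R : realType.
Implicit Types (f g : R -> R[i]) (t : R).

(** * Derivatives of complex-valued functions of a real variable *)

Definition is_cderive f t (df : R[i]) :=
  is_derive t 1 (fun s => complex.Re (f s)) (complex.Re df) /\
  is_derive t 1 (fun s => complex.Im (f s)) (complex.Im df).

Lemma is_cderive_real (f : R -> R) t df :
  is_derive t 1 f df -> is_cderive (fun s => (f s)%:C) t df%:C.
Proof. by move=> fd; split=> //=; exact: is_derive_cst. Qed.

Lemma is_cderive_cst (c : R[i]) t : is_cderive (fun=> c) t 0.
Proof. by split; exact: is_derive_cst. Qed.

Lemma is_cderiveD f g t df dg :
  is_cderive f t df -> is_cderive g t dg ->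
  is_cderive (fun s => f s + g s) t (df + dg).
Proof.
move=> [f1 f2] [g1 g2]; split; rewrite raddfD.
  under eq_fun do rewrite raddfD.
  exact: is_deriveD.
under eq_fun do rewrite raddfD.
exact: is_deriveD.
Qed.

Lemma complexReD (x y : R[i]) : complex.Re (x + y) = complex.Re x + complex.Re y.
Proof. by case: x y => [a b] [c d]. Qed.

Lemma complexImD (x y : R[i]) : complex.Im (x + y) = complex.Im x + complex.Im y.
Proof. by case: x y => [a b] [c d]. Qed.

Lemma complexReM (x y : R[i]) : complex.Re (x * y) =
  complex.Re x * complex.Re y - complex.Im x * complex.Im y.
Proof. by case: x y => [a b] [c d]. Qed.

Lemma complexImM (x y : R[i]) : complex.Im (x * y) =
  complex.Re x * complex.Im y + complex.Im x * complex.Re y.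
Proof. by case: x y => [a b] [c d]. Qed.

Lemma is_cderiveM f g t df dg :
  is_cderive f t df -> is_cderive g t dg ->
  is_cderive (fun s => f s * g s) t (df * g t + f t * dg).
Proof.
move=> [f1 f2] [g1 g2]; split.
  under eq_fun do rewrite complexReM.
  by apply: is_derive_eq; rewrite /GRing.scale /= complexReD !complexReM; ring.
under eq_fun do rewrite complexImM.
by apply: is_derive_eq; rewrite /GRing.scale /= complexImD !complexImM; ring.
Qed.

Lemma is_cderive_horner (P : {poly R[i]}) t :
  is_cderive (fun s => P.[s%:C]) t P^`().[t%:C].
Proof.
elim/poly_ind: P => [|P c IH].
  rewrite deriv0; under [X in is_cderive X]eq_fun do rewrite horner0.
  by rewrite horner0; exact: is_cderive_cst.
under [X in is_cderive X]eq_fun do rewrite hornerMXaddC.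
rewrite derivMXaddC hornerD hornerM hornerX addrC.
rewrite -[X in is_cderive _ _ X]addr0.
apply: is_cderiveD; last exact: is_cderive_cst.
rewrite -[X in _ + X]mulr1; apply: is_cderiveM => //.
by apply: is_cderive_real; exact: is_derive_id.
Qed.

Definition phase (x : R) : R[i] := cos x +i* sin x.

Lemma is_cderive_phase (f : R -> R) t df : is_derive t 1 f df ->
  is_cderive (fun s => phase (f s)) t ('i * df%:C * phase (f t)).
Proof.
move=> fd; split;
  rewrite /= !(mul0r, mul1r, mulr0, mulr1, add0r, sub0r, addr0, subr0, oppr0) /=.
  rewrite mulrC -mulNr.
  by apply: (@is_derive1_comp _ cos f) => //; exact: is_derive_cos.
rewrite mulrC.
by apply: (@is_derive1_comp _ sin f).
Qed.

Lemma is_cderive_eq0 f t T df : (forall s, T < s -> f s = 0) -> T < t ->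
  is_cderive f t df -> df = 0.
Proof.
move=> f0 Tt [f1 f2].
have nr : \forall s \near t, T < s by exact: lt_nbhsr.
apply/eqP; rewrite eq_complex; apply/andP; split; apply/eqP => /=.
  rewrite -(@derive_val _ _ _ _ _ _ _ f1).
  rewrite (@near_eq_derive _ _ _ _ (cst 0)) ?derive_cst //.
  by near=> s; rewrite f0//; near: s.
rewrite -(@derive_val _ _ _ _ _ _ _ f2).
rewrite (@near_eq_derive _ _ _ _ (cst 0)) ?derive_cst //.
by near=> s; rewrite f0//; near: s.
Unshelve. all: by end_near. Qed.

(** * Spherical waves along a line *)

Definition offset (p : R) : {poly R[i]} := 'X - p%:C%:P.
Definition quad (p d : R) : {poly R[i]} := offset p ^+ 2 + (d ^+ 2)%:C%:P.
Definition dist (p d t : R) : R := Num.sqrt ((t - p) ^+ 2 + d ^+ 2).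

(** With [r = dist p d t], the [l]-th derivative of [exp (i k r) / r] is
[exp (i k r) / r ^+ (2 * l + 1)] times [U + r * V] for two polynomials [U], [V]
in [t]; differentiating this shape once more gives the recursion. *)
Fixpoint jet (k p d : R) (l : nat) : {poly R[i]} * {poly R[i]} :=
  if l is l'.+1 then
    let: (U, V) := jet k p d l' in
    let T := offset p in let q := quad p d in
    (('i * k%:C) *: (T * q * V) - (2 * l' + 1)%:R *: (T * U) + q * U^`(),
     ('i * k%:C) *: (T * U) - (2 * l')%:R *: (T * V) + q * V^`())
  else (1, 0).

Definition wave (k p d : R) (l : nat) (t : R) : R[i] :=
  phase (k * dist p d t) * ((dist p d t)^-1 ^+ (2 * l + 1))%:C
  * ((jet k p d l).1.[t%:C] + (dist p d t)%:C * (jet k p d l).2.[t%:C]).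

Lemma dist_gt0 p d t : 0 < d -> 0 < dist p d t.
Proof. by move=> d0; rewrite sqrtr_gt0 ltr_wpDl ?sqr_ge0 ?exprn_gt0. Qed.

Lemma horner_quad p d t : (quad p d).[t%:C] = (dist p d t ^+ 2)%:C.
Proof.
rewrite !hornerE sqr_sqrtr ?addr_ge0 ?sqr_ge0 //.
by rewrite -!rmorphB -!rmorphXn -rmorphD.
Qed.

Lemma is_derive_dist p d t : 0 < d ->
  is_derive t 1 (dist p d) ((t - p) / dist p d t).
Proof.
move=> d0.
have q0 : 0 < (t - p) ^+ 2 + d ^+ 2 by rewrite ltr_wpDl ?sqr_ge0 ?exprn_gt0.
have := is_derive1_sqrt q0; rewrite -/(dist p d t) => sd.
have qd : is_derive t 1 (fun s : R => (s - p) ^+ 2 + d ^+ 2) (2 * (t - p)).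
  apply: is_derive_eq; rewrite /GRing.scale /=; ring.
have := @is_derive1_comp _ Num.sqrt (fun s : R => (s - p) ^+ 2 + d ^+ 2)
  t _ _ sd qd.
have r0 := dist_gt0 p t d0.
by congr is_derive; field; rewrite gt_eqF.
Qed.

Lemma wave_factor k p d l t : wave k p d l t =
  phase (k * dist p d t) / (dist p d t)%:C / (quad p d).[t%:C] ^+ l *
  ((jet k p d l).1.[t%:C] + (dist p d t)%:C * (jet k p d l).2.[t%:C]).
Proof.
rewrite horner_quad /wave !rmorphXn /= fmorphV /=.
by rewrite addn1 exprS exprM !exprVn; ring.
Qed.

Lemma wave0 (k p d t : R) :
  wave k p d 0 t = phase (k * dist p d t) / (dist p d t)%:C.
Proof.
by rewrite /wave /= hornerC horner0 mulr0 addr0 mulr1 muln0 add0n expr1 -fmorphV.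
Qed.

Lemma is_cderive_wave k p d l t : 0 < d ->
  is_cderive (wave k p d l) t (wave k p d l.+1 t).
Proof.
move=> d0; have r0 := dist_gt0 p t d0.
have rd := is_derive_dist p t d0.
have dph : is_derive t 1 (fun s => k * dist p d s) (k * ((t - p) / dist p d t)).
  by apply: is_derive_eq; rewrite /GRing.scale /=; ring.
have rn0 : dist p d t != 0 by rewrite gt_eqF.
have dinv := is_derive_eq (is_deriveX (2 * l + 1) (is_deriveV rn0 rd)) erefl.
have := is_cderiveM (is_cderiveM (is_cderive_phase dph) (is_cderive_real dinv))
 (is_cderiveD (is_cderive_horner (jet k p d l).1 t)
   (is_cderiveM (is_cderive_real rd) (is_cderive_horner (jet k p d l).2 t))).
have -> : (fun y : R => (dist p d y)^-1) ^+ (2 * l + 1) =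
    (fun y : R => (dist p d y)^-1 ^+ (2 * l + 1)).
  by apply/funext => y; rewrite fctE.
congr is_cderive; rewrite /wave /=.
case: (jet k p d l) => U V /=.
have qt := horner_quad p d t.
have Tt : (offset p).[t%:C] = t%:C - p%:C by rewrite !hornerE.
move: (quad p d) (offset p) qt Tt => q T qt Tt; rewrite !hornerE qt Tt.
have -> : (2 * l.+1 + 1 = (2 * l) + 3)%N by lia.
rewrite addn1 /= /GRing.scale /=.
rewrite !(rmorphM, rmorphXn, rmorphN, rmorphV, rmorphB, rmorph_nat) ?unitfE //=.
rewrite exprS exprD -!natr1 !natrM.
have rC : (dist p d t)%:C != 0 by rewrite fmorph_eq0.
set rho := (dist p d t)%:C in rC *; set Z := _ ^+ (2 * l).
- by field.
- by rewrite expf_neq0.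
Qed.

Lemma poly_eq0_ray (P : {poly R[i]}) T :
  (forall t, T < t -> P.[t%:C] = 0) -> P = 0.
Proof.
move=> P0; apply/eqP/negPn/negP => Pn0.
pose pts := [seq (T + n.+1%:R)%:C | n <- iota 0 (size P)] : seq R[i].
have : (size pts < size P)%N.
  apply: max_poly_roots => //.
    apply/allP => _ /mapP[n _ ->]; apply/rootP; apply: P0.
    by rewrite ltrDl ltr0n.
  rewrite map_inj_uniq ?iota_uniq // => m n /complexI/addrI/eqP.
  by rewrite eqr_nat eqSS => /eqP.
by rewrite size_map size_iota ltnn.
Qed.

Lemma quad_root_eq p d p' d' : 0 < d -> 0 < d' ->
  (quad p' d').[p +i* d] = 0 -> p' = p /\ d' = d.
Proof.
move=> d0 d'0; rewrite !hornerE /= => /eqP.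
rewrite eq_complex /= => /andP[/eqP hr /eqP hi].
have pp : p' = p.
  suff : (p - p') * d = 0.
    by move/eqP; rewrite mulf_eq0 [d == 0]gt_eqF // orbF subr_eq0 => /eqP.
  by lra.
split=> //; apply/eqP; rewrite -(@eqrXn2 _ 2) ?ltW //; apply/eqP.
by rewrite pp in hr; lra.
Qed.

Lemma quad_root p d : (quad p d).[p +i* d] = 0.
Proof.
rewrite !hornerE /=; apply/eqP; rewrite eq_complex /=.
by apply/andP; split; apply/eqP; ring.
Qed.

(** At the root [p +i* d] of [quad p d], where the distance vanishes, the
recursion multiplies [U] by the nonzero number [- (2 * l + 1) * d * i]: every
derivative makes the singularity of the wave at that root worse by one full
order. *)
Lemma jet_root_neq0 k p d l : 0 < d -> (jet k p d l).1.[p +i* d] != 0.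
Proof.
move=> d0; elim: l => [|l /=]; first by rewrite hornerC oner_eq0.
case: (jet k p d l) => U V /= Un0.
have q0 := quad_root p d.
have T0 : (offset p).[p +i* d] != 0.
  by rewrite !hornerE eq_complex /= negb_and orbC subr0 gt_eqF.
move: (quad p d) (offset p) q0 T0 => q T q0 T0; rewrite !hornerE q0.
rewrite [X in X != 0](_ : _ = - ((2 * l + 1)%:R * T.[p +i* d] * U.[p +i* d])).
  by rewrite oppr_eq0 !mulf_neq0 // pnatr_eq0 addn1.
by rewrite /=; ring.
Qed.

(** A differential equation whose leading coefficient is nonzero at the
singularity [z = p +i* d] cannot annihilate the wave, because the term of
highest order is the most singular one.  The formal version of this: clearing
denominators turns the equation into [U + r * V = 0] with [U], [V] polynomials
and [r] the distance, hence [U ^+ 2 = q * V ^+ 2] with [q = quad p d]; at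
[z] the right-hand side is zero and the left-hand side is not. *)
Lemma wave_not_annihilated k p d T J (e : nat -> {poly R[i]}) : 0 < d ->
  (e J).[p +i* d] != 0 ->
  ~ (forall t, T < t -> \sum_(l < J.+1) (e l).[t%:C] * wave k p d l t = 0).
Proof.
move=> d0 eJ sum0; pose q := quad p d; pose z := p +i* d.
pose U := \sum_(l < J.+1) e l * q ^+ (J - l) * (jet k p d l).1.
pose V := \sum_(l < J.+1) e l * q ^+ (J - l) * (jet k p d l).2.
have UV t : T < t -> U.[t%:C] = - ((dist p d t)%:C * V.[t%:C]).
  move=> Tt; apply/eqP; rewrite -addr_eq0; apply/eqP.
  pose r : R[i] := (dist p d t)%:C.
  have r0 : r != 0 by rewrite fmorph_eq0 gt_eqF ?dist_gt0.
  have q0 : q.[t%:C] != 0 by rewrite horner_quad rmorphXn expf_neq0.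
  have ph0 : phase (k * dist p d t) != 0.
    rewrite eq_complex /= negb_and; have := cos2Dsin2 (k * dist p d t).
    case: eqP => //= ->; apply: contra_eq_neq => ->.
    by rewrite expr0n addr0 eq_sym oner_eq0.
  apply: (mulfI (mulf_neq0 (mulf_neq0 ph0 (invr_neq0 r0))
    (invr_neq0 (expf_neq0 J q0)))).
  rewrite mulr0 -[RHS](sum0 _ Tt) !horner_sum mulr_sumr -big_split mulr_sumr /=.
  apply: eq_bigr => l _; rewrite wave_factor -/q -/r !hornerM !horner_exp.
  have -> : q.[t%:C] ^+ J = q.[t%:C] ^+ l * q.[t%:C] ^+ (J - l).
    by rewrite -exprD subnKC // -ltnS.
  have := expf_neq0 (J - l) q0; have := expf_neq0 l q0.
  move: (q.[t%:C] ^+ (J - l)) (q.[t%:C] ^+ l) => x y x0 y0.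
  by field; rewrite r0 x0 y0.
have /eqP : U ^+ 2 - q * V ^+ 2 = 0.
  apply: (@poly_eq0_ray _ T) => t Tt.
  rewrite hornerD hornerN horner_exp UV // [(q * _).[_] ]hornerM horner_exp.
  by rewrite horner_quad rmorphXn /=; ring.
rewrite subr_eq0 => /eqP UqV.
have : (U ^+ 2).[z] = 0 by rewrite UqV hornerM quad_root mul0r.
apply/eqP; rewrite horner_exp expf_neq0 //.
rewrite horner_sum big_ord_recr big1 /= => [|l _]; last first.
  rewrite !hornerM horner_exp quad_root expr0n subn_eq0 leqNgt ltn_ord /=.
  by rewrite mulr0 mul0r.
by rewrite add0r subnn expr0 mulr1 !hornerM !mulf_neq0 // jet_root_neq0.
Qed.

(** Differentiate the relation repeatedly.  The complex singularity [z] of the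
wave [a] is regular for the other waves, so [local_dependence] combines the
derivatives, with a leading coefficient nonzero at [z], into a relation from
which all the other waves have disappeared; [wave_not_annihilated] forbids it
unless [c a = 0]. *)
Lemma wave_independent (I : finType) (p d : I -> R) (c : I -> R[i]) (k T : R)
    (a : I) :
  (forall b, 0 < d b) ->
  (forall b, c b != 0 -> p b = p a -> d b = d a -> b = a) ->
  (forall t, T < t -> \sum_b c b * wave k (p b) (d b) 0 t = 0) ->
  c a = 0.
Proof.
move=> d0 sep sum0; apply/eqP/negPn/negP => ca.
have waves l t : T < t -> \sum_b c b * wave k (p b) (d b) l t = 0.
  elim: l t => [|l IH] t Tt; first exact: sum0.
  apply: (is_cderive_eq0 IH Tt).
  rewrite /index_enum; elim: (Finite.enum I) => [|b r IHr].
    rewrite big_nil; under [X in is_cderive X]eq_fun do rewrite big_nil.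
    exact: is_cderive_cst.
  rewrite big_cons; under [X in is_cderive X]eq_fun do rewrite big_cons.
  apply: is_cderiveD => //.
  rewrite -[c b * _]add0r -{1}(mul0r (wave k (p b) (d b) l t)).
  by apply: is_cderiveM; [exact: is_cderive_cst|exact: is_cderive_wave].
pose others := [seq b <- enum I | (b != a) && (c b != 0)].
pose q b := quad (p b) (d b).
pose Q := \prod_(b <- others) q b.
pose cof b := \prod_(b' <- rem b others) q b'.
have QE b : b \in others -> Q = q b * cof b.
  by move=> bo; rewrite /Q (perm_big _ (perm_to_rem bo)) big_cons.
pose z := p a +i* d a.
have Qz : Q.[z] != 0.
  rewrite horner_prod prodf_seq_neq0; apply/allP => b.
  rewrite mem_filter => /andP[/andP[ba cb] _]; apply/implyP => _.
  apply: contra_neq ba => /quad_root_eq[] //; exact: sep.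
(* Multiplying the l-th derivative by Q ^+ l makes the coefficients of the other
   waves polynomial; as Q is nonzero at z, regularity there is not lost. *)
pose u l (bi : I * bool) := cof bi.1 ^+ l *
  (if bi.2 then (jet k (p bi.1) (d bi.1) l).2
   else (jet k (p bi.1) (d bi.1) l).1).
have [J [e [eJ e0]]] := local_dependence z
  [seq (b, i) | b <- others, i <- [:: true; false]] u.
have e1 b : b \in others ->
    \sum_(l < J.+1) e l * (cof b ^+ l * (jet k (p b) (d b) l).1) = 0.
  by move=> bo; apply: (e0 (b, false)); apply: allpairs_f => //; rewrite !inE.
have e2 b : b \in others ->
    \sum_(l < J.+1) e l * (cof b ^+ l * (jet k (p b) (d b) l).2) = 0.
  by move=> bo; apply: (e0 (b, true)); apply: allpairs_f.
apply: (@wave_not_annihilated k (p a) (d a) T J (fun l => e l * Q ^+ l)) => //.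
  by rewrite hornerM horner_exp mulf_neq0 ?expf_neq0.
move=> t Tt.
have : \sum_(l < J.+1) (e l * Q ^+ l).[t%:C] *
    (\sum_b c b * wave k (p b) (d b) l t) = 0.
  by apply: big1 => l _; rewrite waves // mulr0.
under eq_bigr do rewrite mulr_sumr.
rewrite exchange_big (bigD1 a) //= [X in _ + X]big1 => [|b ba].
  rewrite addr0 => h; apply: (mulfI ca); rewrite mulr0 -[RHS]h mulr_sumr.
  by apply: eq_bigr => l _; ring.
have [->|cb] := eqVneq (c b) 0; first by apply: big1 => l _; rewrite mul0r mulr0.
have bo : b \in others by rewrite mem_filter ba cb mem_enum.
pose r : R[i] := (dist (p b) (d b) t)%:C.
have qn0 : (q b).[t%:C] != 0.
  by rewrite horner_quad fmorph_eq0 expf_neq0 // gt_eqF ?dist_gt0.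
transitivity (c b * phase (k * dist (p b) (d b) t) / r * (
   (\sum_(l < J.+1) e l * (cof b ^+ l * (jet k (p b) (d b) l).1)).[t%:C] + r *
   (\sum_(l < J.+1) e l * (cof b ^+ l * (jet k (p b) (d b) l).2)).[t%:C])).
  rewrite !horner_sum mulr_sumr -big_split mulr_sumr /=; apply: eq_bigr => l _.
  rewrite wave_factor (QE _ bo) -/(q b) -/r !hornerM !horner_exp hornerM exprMn.
  have := expf_neq0 l qn0; move: ((q b).[t%:C] ^+ l) => x x0.
  have r0 : r != 0 by rewrite fmorph_eq0 gt_eqF ?dist_gt0.
  by field; rewrite r0 x0.
by rewrite e1 // e2 // horner0 mulr0 addr0 mulr0.
Qed.

(** * Point sources below the plane *)

Implicit Types (x y : 'rV[R]_3).

Notation coord1 := (ord0 : 'I_3).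
Notation coord2 := (lift ord0 ord0 : 'I_3).
Notation coord3 := (ord_max : 'I_3).

Lemma enormE x : enorm x =
  Num.sqrt (x 0 coord1 ^+ 2 + x 0 coord2 ^+ 2 + x 0 coord3 ^+ 2).
Proof.
rewrite /enorm !big_ord_recl big_ord0 addr0 addrA.
by congr (Num.sqrt (_ + x 0 _ ^+ 2)); apply: val_inj.
Qed.

Lemma G0_real (k : R) x : 0 <= k ->
  G0 (k ^+ 2)%:C x = (4 * pi)^-1%:C * (phase (k * enorm x) / (enorm x)%:C).
Proof.
move=> k0; rewrite /G0 rmorphXn /= sqrCK ?lecR // -complexiE /expC.
have -> : 'i * k%:C * (enorm x)%:C = 0 +i* (k * enorm x).
  by apply/eqP; rewrite eq_complex /=; apply/andP; split; apply/eqP; ring.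
by rewrite /= expR0 mul1r rmorphM invfM -(fmorphV _ (4 * pi)) mulrCA.
Qed.

Definition plane_point (t s : R) : 'rV[R]_3 :=
  \row_i (if i == coord1 then t else if i == coord3 then 0 else s).

Lemma on_plane_point t s : on_plane (plane_point t s).
Proof. by rewrite /on_plane mxE. Qed.

Lemma enorm_plane_point t s x : x 0 coord3 < 0 ->
  enorm (plane_point t s - x) =
  dist (x 0 coord1) (Num.sqrt ((s - x 0 coord2) ^+ 2 + x 0 coord3 ^+ 2)) t.
Proof.
move=> x3; rewrite enormE /dist sqr_sqrtr ?addr_ge0 ?sqr_ge0 // !mxE /=.
by rewrite sub0r sqrrN addrA.
Qed.

(** Among the sources with nonzero coefficient take one, [xi b], nearest to the
plane, and follow the line through its foot.  The squared distances to the
sources are quadratic in the parameter, and the one of [xi b] coincides with no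
other: it would belong to a source with the same first coordinate and at the same
distance from the foot, and [xi b] is the only such source that is no closer to
the plane than [xi b].  The ray
[x 0 0 > T] suffices and lets the observation point avoid any given point. *)
Lemma distinct_sources_independent (I : finType) (xi : I -> 'rV[R]_3)
    (c : I -> R[i]) (k T : R) (a : I) : 0 <= k ->
  injective xi -> (forall j, lower_half_space (xi j)) ->
  (forall x, on_plane x -> T < x 0 coord1 ->
     \sum_j c j * G0 (k ^+ 2)%:C (x - xi j) = 0) ->
  c a = 0.
Proof.
move=> k0 xi_inj low sum0; apply/eqP/negPn/negP => ca.
case: (@arg_maxP _ _ _ a (fun j => c j != 0) (fun j => xi j 0 coord3) ca).
move=> b cb top.
pose d j := Num.sqrt ((xi b 0 coord2 - xi j 0 coord2) ^+ 2 + xi j 0 coord3 ^+ 2).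
have d2 j : d j ^+ 2 = (xi b 0 coord2 - xi j 0 coord2) ^+ 2 + xi j 0 coord3 ^+ 2.
  by rewrite sqr_sqrtr // addr_ge0 ?sqr_ge0.
suff : c b = 0 by exact/eqP.
apply: (@wave_independent _ (fun j => xi j 0 coord1) d c k T)
  => [j|j cj p_eq d_eq|t Tt].
- have := low j; rewrite /lower_half_space => lj.
  by rewrite sqrtr_gt0 ltr_wpDl ?sqr_ge0 // exprn_even_gt0 //= lt_eqF.
- have := top j cj; have := low j; have := low b.
  rewrite /lower_half_space => lb lj le_jb.
  have := d2 j; rewrite d_eq d2 subrr expr0n add0r => h.
  have le2 : xi b 0 coord3 ^+ 2 <= xi j 0 coord3 ^+ 2.
    by rewrite -sqrrN -[leRHS]sqrrN ler_pXn2r ?nnegrE ?oppr_ge0 ?lerN2 // ltW.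
  have e2 : xi j 0 coord2 = xi b 0 coord2.
    apply/eqP; rewrite eq_sym -subr_eq0 -sqrf_eq0 eq_le sqr_ge0 andbT.
    by rewrite -(lerD2r (xi j 0 coord3 ^+ 2)) -h add0r.
  have e3 : xi j 0 coord3 = xi b 0 coord3.
    rewrite e2 subrr expr0n add0r in h; apply/eqP.
    by rewrite -eqr_opp -(@eqrXn2 _ 2) ?oppr_ge0 ?ltW // !sqrrN h.
  apply: xi_inj; apply/rowP => i.
  case: (unliftP coord1 i) => [i'|] ->; last by [].
  case: (unliftP ord0 i') => [i''|] ->; last by [].
  have -> : lift ord0 (lift ord0 i'') = coord3.
    by apply: val_inj; rewrite /= (ord1 i'').
  by [].
have := sum0 (plane_point t (xi b 0 coord2)) (on_plane_point _ _).
rewrite mxE /= => /(_ Tt) h.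
have pi4 : (4 * pi)^-1%:C != 0 :> R[i].
  by rewrite fmorph_eq0 invr_eq0 mulf_neq0 ?pnatr_eq0 // gt_eqF ?pi_gt0.
apply: (mulfI pi4); rewrite mulr0 -[RHS]h mulr_sumr; apply: eq_bigr => j _.
rewrite G0_real // (enorm_plane_point _ _ (low j)) wave0 mulrCA.
by [].
Qed.

(** The version for possibly coinciding sources, needed because the sources of
the two configurations are going to be superposed. *)
Lemma sources_independent (I : finType) (xi : I -> 'rV[R]_3)
    (c : I -> R[i]) (k T : R) (w : 'rV[R]_3) : 0 <= k ->
  (forall j, lower_half_space (xi j)) ->
  (forall x, on_plane x -> T < x 0 coord1 ->
     \sum_j c j * G0 (k ^+ 2)%:C (x - xi j) = 0) ->
  \sum_(j | xi j == w) c j = 0.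
Proof.
move=> k0 low sum0.
have [wxi|wxi] := boolP (w \in codom xi); last first.
  apply: big_pred0 => j; apply/negP => /eqP xjw.
  by rewrite -xjw codom_f in wxi.
pose node j : seq_sub (codom xi) := SeqSub (codom_f xi j).
have := @distinct_sources_independent (seq_sub (codom xi)) val
  (fun v => \sum_(j | xi j == val v) c j) k T (SeqSub wxi) k0 val_inj.
apply=> [v|x xP Tx].
  by have /codomP[j ->] := valP v; exact: low.
rewrite -[RHS](sum0 x xP Tx) (partition_big node predT) //=.
apply: eq_bigr => v _; rewrite mulr_suml; apply: eq_big => [j|j /eqP -> //].
by rewrite -val_eqE.
Qed.

(** Separation of variables: freeze [y], and use the independence in [x] on a ray
that misses [y]; the restriction to [x <> y] therefore costs nothing. *)
Lemma source_pairs_independent (I : finType) (xi : I -> 'rV[R]_3)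
    (Q : I -> I -> R[i]) (k : R) (v w : 'rV[R]_3) : 0 <= k ->
  (forall j, lower_half_space (xi j)) ->
  (forall x y, on_plane x -> on_plane y -> x <> y ->
     \sum_i \sum_j
       Q i j * G0 (k ^+ 2)%:C (x - xi i) * G0 (k ^+ 2)%:C (y - xi j) = 0) ->
  \sum_(i | xi i == v) \sum_(j | xi j == w) Q i j = 0.
Proof.
move=> k0 low sum0; rewrite exchange_big.
apply: (@sources_independent _ xi (fun j => \sum_(i | xi i == v) Q i j) k 0)
  => // y yP _.
transitivity (\sum_(i | xi i == v) \sum_j Q i j * G0 (k ^+ 2)%:C (y - xi j)).
  by rewrite exchange_big; apply: eq_bigr => j _; rewrite mulr_suml.
apply: (@sources_independent _ xi _ k (y 0 coord1)) => // x xP yx.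
have xy : x <> y by move=> xy; rewrite xy ltxx in yx.
rewrite -[RHS](sum0 x y xP yP xy); apply: eq_bigr => i _.
by rewrite mulr_suml; apply: eq_bigr => j _; ring.
Qed.
End PointSources.

(** * Matching the sources and recovering the matrices *)

Lemma mxsub_mul_bij (F : pzSemiRingType) m n (s : 'I_m -> 'I_n)
    (A B : 'M[F]_n) :
  bijective s -> mxsub s s A *m mxsub s s B = mxsub s s (A *m B).
Proof.
move=> s_bij; apply/matrixP => i j.
rewrite !mxE [RHS](reindex s) /=; last exact: onW_bij.
by apply: eq_bigr => l _; rewrite !mxE.
Qed.

Lemma mxsub_invmx (F : comUnitRingType) m n (s : 'I_m -> 'I_n) (A : 'M[F]_n) :
  bijective s -> A \in unitmx -> invmx (mxsub s s A) = mxsub s s (invmx A).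
Proof.
move=> s_bij uA.
have s1 : mxsub s s (1%:M : 'M[F]_n) = 1%:M.
  by apply/matrixP => i j; rewrite !mxE (inj_eq (bij_inj s_bij)).
have inv1 : mxsub s s A *m mxsub s s (invmx A) = 1%:M.
  by rewrite mxsub_mul_bij // mulmxV.
have [uB _] := mulmx1_unit inv1.
by rewrite -[LHS]mulmx1 -inv1 mulKmx.
Qed.

(** If no [xi' i] were equal to [xi j], the hypothesis would make the whole row
[j] of the invertible matrix [P] vanish. *)
Lemma matching_source (F : fieldType) (X : eqType) m n
    (xi : 'I_m -> X) (xi' : 'I_n -> X)
    (P : 'M[F]_m) (P' : 'M[F]_n) :
  injective xi -> P \in unitmx ->
  (forall v w, \sum_(i | xi i == v) \sum_(j | xi j == w) P i j =
     \sum_(i | xi' i == v) \sum_(j | xi' j == w) P' i j) ->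
  forall j, exists i, xi' i = xi j.
Proof.
move=> xi_inj uP PP' j; have [//|no_i] := pselect (exists i, xi' i = xi j).
have row0 l : P j l = 0.
  have := PP' (xi j) (xi l).
  rewrite (big_pred1 j) => [|i]; last by rewrite (inj_eq xi_inj).
  rewrite (big_pred1 l) => [|i]; last by rewrite (inj_eq xi_inj).
  move=> ->; apply: big_pred0 => i; apply/negP => /eqP xi'i.
  by apply: no_i; exists i.
have /matrixP/(_ j j)/eqP := mulmxV uP.
by rewrite !mxE eqxx big1 => [|l _]; rewrite ?row0 ?mul0r // eq_sym oner_eq0.
Qed.

Lemma spectral_diag_eigenvalue (C : numClosedFieldType) n (A : 'M[C]_n) i :
  A \is normalmx -> eigenvalue A (spectral_diag A 0 i).
Proof.
move=> /orthomx_spectralP AE; apply/eigenvalueP.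
have uS := spectral_unit A.
exists (row i (spectralmx A)).
  rewrite -row_mul {2}AE !mulmxA mulmxV // mul1mx.
  by rewrite row_mul row_diag_mx -scalemxAl -rowE.
apply/eqP => S0; have /matrixP/(_ i i) := mulmxV uS.
have : row i (spectralmx A) *m invmx (spectralmx A) = 0 by rewrite S0 mul0mx.
rewrite -row_mul mulmxV // => /rowP/(_ i).
by rewrite !mxE eqxx => /eqP; rewrite oner_eq0.
Qed.

(** In eigenbases of [A] and [B] an intertwiner of [f(A)] and [f(B)] is a matrix
[W] with [W i j * f (a j) = f (b i) * W i j]; since [f] separates the eigenvalues,
it satisfies the same equations without [f]. *)
Lemma hermfun_intertwine (R : realType) (f : R -> R) m n
    (A : 'M[R[i]]_m) (B : 'M[R[i]]_n) (M : 'M[R[i]]_(n, m)) :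
  A \is hermsymmx -> B \is hermsymmx ->
  (forall a b : R, eigenvalue A a%:C -> eigenvalue B b%:C ->
     f a = f b -> a = b) ->
  M *m hermfun f A = hermfun f B *m M -> M *m A = B *m M.
Proof.
move=> hA hB f_inj; rewrite /hermfun.
have nA := hermitian_normalmx hA; have nB := hermitian_normalmx hB.
have AE := orthomx_spectralP nA; have BE := orthomx_spectralP nB.
have real (l : nat) (N : 'M[R[i]]_l) j : N \is hermsymmx ->
    spectral_diag N 0 j = (complex.Re (spectral_diag N 0 j))%:C.
  by move=> /hermitian_spectral_diag_real/mxOverP/(_ 0 j) rj; rewrite RRe_real.
have eA := fun j => spectral_diag_eigenvalue j nA.
have eB := fun j => spectral_diag_eigenvalue j nB.
have uA := spectral_unit A; have uB := spectral_unit B.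
have rA := fun j => real _ A j hA; have rB := fun j => real _ B j hB.
move: (spectralmx A) (spectral_diag A) (spectralmx B) (spectral_diag B)
  AE BE eA eB uA uB rA rB.
move=> S D S' D' AE BE eA eB uA uB rA rB.
set fD := diag_mx (map_mx _ D); set fD' := diag_mx (map_mx _ D') => h.
pose W := S' *m M *m invmx S.
have fW : W *m fD = fD' *m W.
  have -> : fD' *m W =
      S' *m (invmx S' *m fD' *m S' *m M) *m invmx S.
    rewrite /W -(mulmxA (invmx S')) -(mulmxA (invmx S')).
    by rewrite (mulKVmx uB) !mulmxA.
  by rewrite -h /W !mulmxA (mulmxK uA).
have WD : W *m diag_mx D = diag_mx D' *m W.
  clearbody W.
  apply/matrixP => i j; have /matrixP/(_ i j) := fW.
  rewrite !mul_mx_diag !mul_diag_mx !mxE mulrC => fWij.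
  have [->|Wn0] := eqVneq (W i j) 0; first by rewrite mul0r mulr0.
  rewrite mulrC; congr (_ * _); rewrite rA rB; congr (_%:C).
  apply: f_inj; [by rewrite -rA|by rewrite -rB|].
  by apply: (@complexI R); apply: (mulIf Wn0).
have SM : S' *m M = W *m S by rewrite /W mulmxKV.
clearbody W; have MS : M = invmx S' *m (W *m S) by rewrite -SM mulKmx.
rewrite AE BE; rewrite -(mulmxA _ S' M) SM {1}MS -!mulmxA (mulKVmx uA).
by rewrite (mulmxA W) WD -mulmxA.
Qed.

Lemma cos_eq0 (R : realType) (u : R) :
  cos u = 0 -> exists m : int, u = (2^-1 + m%:~R) * pi.
Proof.
move=> cu.
have pi0 : 0 < pi :> R := pi_gt0 R.
(* As [cos ^+ 2] has period [pi], one may assume that [u] lies between 0 and [pi]. *)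
have cos2_per : periodic (fun v : R => cos v ^+ 2) pi.
  by move=> v /=; rewrite [X in v + X]splitr addrA !cosDpihalf sinDpihalf sqrrN.
pose m := Num.floor (u / pi).
have /andP[mu um] := floor_itv (u / pi).
pose v := u - m%:~R * pi.
have v0 : 0 <= v by rewrite subr_ge0 -ler_pdivlMr.
have vpi : v <= pi.
  have := um; rewrite ltr_pdivrMr // intrD mulrDl mul1r => /ltW.
  by rewrite /v lerBlDl.
have cv : cos v = 0.
  apply/eqP; rewrite -sqrf_eq0; apply/eqP.
  transitivity (cos u ^+ 2); last by rewrite cu expr0n.
  rewrite /v; case: (m) => n.
    by rewrite -(periodicn cos2_per n (u - _)) -mulr_natl subrK.
  by rewrite NegzE mulrNz mulNr opprK mulr_natl (periodicn cos2_per).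
exists m; have -> : u = v + m%:~R * pi by rewrite subrK.
rewrite mulrDl addrC [RHS]addrC; congr (_ + _); rewrite mulrC.
by apply: (@cos_inj R); rewrite ?cos_pihalf // in_itv /=;
  apply/andP; split=> //; lra.
Qed.

Lemma tan_inj_window (R : realType) (u v : R) :
  cos u != 0 -> cos v != 0 -> `|u - v| < pi -> tan u = tan v -> u = v.
Proof.
wlog : u v / v <= u => [hw cu cv uv t|vu cu cv uv /eqP].
  have [vu|/ltW uv'] := leP v u; first exact: hw.
  by symmetry; apply: hw => //; rewrite distrC.
rewrite /tan eqr_div // => /eqP suv.
apply/eqP/negPn/negP => neq_uv.
have : 0 < sin (u - v).
  apply: sin_gt0_pi; rewrite subr_gt0 lt_neqAle eq_sym neq_uv vu /=.
  by rewrite -[ltLHS]ger0_norm // subr_ge0.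
by rewrite sinD cosN sinN suv mulrN [cos u * _]mulrC subrr ltxx.
Qed.

Lemma cos_half_neq0 (R : realType) n (A : 'M[R[i]]_n) (t : R) :
  avoids_odd_half_pi (2^-1 *: A) -> eigenvalue A t%:C -> cos (t / 2) != 0.
Proof.
move=> av /eigenvalueP[v vA v0]; apply/eqP => /cos_eq0[m tm].
have /negP := av m; apply; apply/eigenvalueP; exists v => //.
by rewrite -tm -scalemxAr vA scalerA rmorphM mulrC fmorphV rmorph_nat.
Qed.

Unset Implicit Arguments.
Set Strict Implicit.

Theorem theorem4p1 (R : realType) (k0 : R) (n1 n2 : nat)
  (theta1 : 'M[R[i]]_n1) (xi1 : 'I_n1 -> 'rV[R]_3)
  (theta2 : 'M[R[i]]_n2) (xi2 : 'I_n2 -> 'rV[R]_3)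
  (hk0 : 0 < k0)
  (h1 : admissible theta1 xi1) (h2 : admissible theta2 xi2)
  (hP1 : \det (Pmx theta1 xi1 (k0 ^+ 2)%:C) != 0)
  (hP2 : \det (Pmx theta2 xi2 (k0 ^+ 2)%:C) != 0)
  (hdata : forall x y : 'rV[R]_3, on_plane x -> on_plane y -> x <> y ->
    Green theta1 xi1 (k0 ^+ 2)%:C x y = Green theta2 xi2 (k0 ^+ 2)%:C x y) :
  exists s : 'I_n1 -> 'I_n2,
    [/\ bijective s,
        forall j, xi2 (s j) = xi1 j,
        forall j j', tan_half theta2 (s j) (s j') = tan_half theta1 j j'
      & forall a : R,
          spectrum_in_window a theta1 -> spectrum_in_window a theta2 ->
          forall j j', theta2 (s j) (s j') = theta1 j j'].
Proof.
have [inj1 low1 herm1 _ av1] := h1; have [inj2 low2 herm2 _ av2] := h2.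
have {hP1} uP1 : Pmx theta1 xi1 (k0 ^+ 2)%:C \in unitmx by rewrite unitmxE unitfE.
have {hP2} uP2 : Pmx theta2 xi2 (k0 ^+ 2)%:C \in unitmx by rewrite unitmxE unitfE.
set P1 := Pmx theta1 xi1 _ in uP1; set P2 := Pmx theta2 xi2 _ in uP2.
have eqP12 v w : \sum_(i | xi1 i == v) \sum_(j | xi1 j == w) P1 i j =
                 \sum_(i | xi2 i == v) \sum_(j | xi2 j == w) P2 i j.
  (* Superpose the first configuration and the opposite of the second. *)
  pose xi (j : 'I_n1 + 'I_n2) := match j with
    inl j => xi1 j | inr j => xi2 j end.
  pose Q (i j : 'I_n1 + 'I_n2) : R[i] := match i, j with
    | inl i, inl j => P1 i j | inr i, inr j => - P2 i j | _, _ => 0 end.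
  have := @source_pairs_independent R _ xi Q k0 v w (ltW hk0).
  rewrite big_sumType /=.
  under eq_bigr do rewrite big_sumType /= [X in _ + X]big1_eq addr0.
  under [X in _ + X]eq_bigr do rewrite big_sumType /= big1_eq add0r sumrN.
  rewrite sumrN => h; apply/eqP; rewrite -subr_eq0; apply/eqP.
  apply: h => [[j|j]|x y xP yP xy]; [exact: low1|exact: low2|].
  have := hdata x y xP yP xy; rewrite /Green => /addrI.
  rewrite -/P1 -/P2 => {}hdata.
  move/eqP: hdata; rewrite -subr_eq0 => /eqP d0.
  rewrite -[RHS]d0 big_sumType /= -sumrN.
  congr (_ + _); apply: eq_bigr => i _; rewrite big_sumType /=.
    by rewrite [X in _ + X]big1 ?addr0 // => j _; rewrite !mul0r.
  rewrite big1 ?add0r -?sumrN => [|j _]; last by rewrite !mul0r.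
  by apply: eq_bigr => j _; rewrite !mulNr.
have [s sE] := fin_all_exists (matching_source inj1 uP1 eqP12).
have [s' s'E] := fin_all_exists
  (matching_source inj2 uP2 (fun v w => esym (eqP12 v w))).
have s_bij : bijective s.
  by exists s' => j; [apply: inj1; rewrite s'E sE|apply: inj2; rewrite sE s'E].
have PE : P1 = mxsub s s P2.
  apply/matrixP => i j; rewrite mxE.
  have := eqP12 (xi1 i) (xi1 j).
  rewrite (big_pred1 i) => [|l]; last by rewrite (inj_eq inj1).
  rewrite (big_pred1 j) => [|l]; last by rewrite (inj_eq inj1).
  rewrite (big_pred1 (s i)) => [|l]; last by rewrite -sE (inj_eq inj2).
  by rewrite (big_pred1 (s j)) => [|l]; last by rewrite -sE (inj_eq inj2).
have PinvE : Pinv theta1 xi1 (k0 ^+ 2)%:C =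
    mxsub s s (Pinv theta2 xi2 (k0 ^+ 2)%:C).
  rewrite -[LHS]invmxK -[Pinv theta2 _ _]invmxK.
  rewrite -/(Pmx _ _ _) -/(Pmx theta2 _ _) -/P1 -/P2.
  by rewrite PE mxsub_invmx.
(* The remaining terms of [Pinv] depend on the positions of the sources only. *)
have tanE j j' : tan_half theta2 (s j) (s j') = tan_half theta1 j j'.
  have /matrixP/(_ j j') := PinvE; rewrite !mxE (inj_eq (bij_inj s_bij)) !sE.
  by case: eqP => [->|_] /addrI ->.
exists s; split=> // a win1 win2 j j'.
(* The permutation matrix of [s] intertwines the two matrices. *)
pose M : 'M[R[i]]_(n2, n1) := \matrix_(i, l) (i == s l)%:R.
have rowM (N : 'M[R[i]]_n1) i l : (M *m N) (s i) l = N i l.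
  rewrite mxE (bigD1 i) //= mxE eqxx mul1r big1 ?addr0 // => i' i'i.
  by rewrite mxE (inj_eq (bij_inj s_bij)) eq_sym (negPf i'i) mul0r.
have colM (N : 'M[R[i]]_n2) i l : (N *m M) i l = N i (s l).
  rewrite mxE (bigD1 (s l)) //= mxE eqxx mulr1 big1 ?addr0 // => i' i'l.
  by rewrite mxE (negPf i'l) mulr0.
suff /matrixP/(_ (s j) j') : M *m theta1 = theta2 *m M by rewrite rowM colM.
apply: (hermfun_intertwine (f := fun t => tan (t / 2))) herm1 herm2 _ _
  => [t1 t2 e1 e2 tt|].
  have /andP[a1 b1] := win1 _ e1; have /andP[a2 b2] := win2 _ e2.
  have pi0 := pi_gt0 R.
  have lt_pi : `|t1 / 2 - t2 / 2| < pi.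
    by rewrite ltr_norml; apply/andP; split; lra.
  have := tan_inj_window (cos_half_neq0 av1 e1) (cos_half_neq0 av2 e2) lt_pi tt.
  lra.
apply/matrixP => i l; have [si _ siK] := s_bij.
by rewrite -(siK i) rowM colM; exact/esym/tanE.
Qed.
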